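(* Let $n\in\mathbb{N}$, $n\geq 2$. Let $f\in A_n$ be such that $f=\sum_{a\in B_n}\alpha_a a$, where $\alpha_a\in\mathbb{C}$ for all $a\in B_n$. Define $$\mathcal{C}_n=\{x\in\mathcal{C} : x_k=0 \text{ for all } k\geq n\},$$ which has $2^n$ elements. For each $k\in\{0,\ldots,n-1\}$, set $$\rho_k=\{a\in B_n : a-E_k(a)\neq 0_{C(\mathcal{C})}\}=\{a\in B_n : E_k(a)=0_{C(\mathcal{C})}\}$$ (the two sets being equal). Then $$\mathsf{L}^{\lambda}_{\mathcal{T}_{\mathcal{C}}}(f)=\max_{k\in\{0,\ldots,n-1\}}\left\{\max_{x\in\mathcal{C}_n}\left\{2^{k+1}\left|\sum_{a\in\rho_k}\pm_{a,x}\,\alpha_a\right|\right\}\right\},$$ where $\pm_{a,x}\in\{+1,-1\}$ is the sign of $a(x)$. Moreover, the cardinality of $\rho_k$ is $|\rho_k|=2^n-2^k$.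
   Context: Convention: $\mathbb{N}$ contains $0$. The Cantor space is $\mathcal{C}=\{(x_n)_{n\in\mathbb{N}} : x_n\in\{0,1\} \text{ for all } n\}$ with its (product) topology. $C(\mathcal{C})$ is the C*-algebra of continuous functions $\mathcal{C}\to\mathbb{C}$ with pointwise operations, supremum norm $\|\cdot\|_\infty$, unit $1_{C(\mathcal{C})}$ (the constant function $1$) and zero $0_{C(\mathcal{C})}$. For $n\in\mathbb{N}$, $\eta_n\in C(\mathcal{C})$ is the coordinate map $\eta_n((z_m)_{m\in\mathbb{N}})=z_n$, and $u_n=2\eta_n-1_{C(\mathcal{C})}$ (so $u_n$ takes values in $\{-1,1\}$). Set $B_0=\emptyset$ and, for $n\geq 1$, $B_n=\{\prod_{j\in F}u_j : \emptyset\neq F\subseteq\{0,\ldots,n-1\}\}$. For $n \in \mathbb{N}$ set $B_n'=\{1_{C(\mathcal{C})}\}\cup B_n$ and $A_n=\operatorname{span}_{\mathbb{C}} B_n'$; one has $|B_n'|=2^n$. $\lambda$ is the state on $C(\mathcal{C})$ (unital norm-one continuous linear functional) determined by $\lambda\left(\prod_{j\in F}u_j\right)=0$ for every nonempty finite $F\subset\mathbb{N}$; it is integration against the product of the uniform probability measures on $\{0,1\}$. For $n\in\mathbb{N}$, $E_n:C(\mathcal{C})\to A_n$ is $E_n(f)=\sum_{a\in B_n'}\lambda(fa)\,a$. The seminorm $\mathsf{L}^{\lambda}_{\mathcal{T}_{\mathcal{C}}}$ (with values in $[0,\infty]$) is, for $f\in C(\mathcal{C})$, $$\mathsf{L}^{\lambda}_{\mathcal{T}_{\mathcal{C}}}(f)=\sup_{n\in\mathbb{N}}\frac{\|f-E_n(f)\|_\infty}{2^{-(n+1)}}.$$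 *)

(* Defs.v *)
From HB Require Import structures.
From mathcomp Require Import all_boot all_order all_algebra finmap complex.
From mathcomp Require Import boolp classical_sets functions cardinality fsbigop.
From mathcomp Require Import reals ereal topology normedtype cantor.

Set Implicit Arguments.
Unset Strict Implicit.
Unset Printing Implicit Defensive.

Import Order.TTheory GRing.Theory Num.Theory.
Import numFieldNormedType.Exports.

Local Open Scope classical_set_scope.
Local Open Scope ring_scope.

(* C(X, K) with pointwise operations. [K^o] is [K] with the topology of its
   norm; for [K := R[i]] this is the usual topology of the complex plane. *)
Definition contfun (X : topologicalType) (K : numFieldType) : Type :=
  continuousType X K^o.

HB.instance Definition _ X K := Choice.on (contfun X K).

Section ContfunAlgebra.
Variables (X : topologicalType) (K : numFieldType).
Implicit Types (f g h : contfun X K) (c : K).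

Definition mkcontfun (F : X -> K) (cF : continuous (F : X -> K^o)) :
  contfun X K := mkcts cF.

Lemma contfunP f g : (forall x, f x = g x) -> f = g.
Proof. by move=> fg; apply/continuousEP => x; exact: fg. Qed.

Lemma contfun_addP f g : continuous ((fun x => f x + g x) : X -> K^o).
Proof.
by move=> x; apply: (@continuousD _ K^o); exact: (@cts_fun X K^o).
Qed.

Lemma contfun_oppP f : continuous ((fun x => - f x) : X -> K^o).
Proof. by move=> x; apply: (@continuousN _ K^o); exact: (@cts_fun X K^o). Qed.

Lemma contfun_mulP f g : continuous ((fun x => f x * g x) : X -> K^o).
Proof. by move=> x; apply: (@continuousM K X); exact: (@cts_fun X K^o). Qed.

Lemma contfun_cstP c : continuous ((fun=> c) : X -> K^o).
Proof. exact: cst_continuous. Qed.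

Definition contfun_add f g := mkcontfun (@contfun_addP f g).
Definition contfun_opp f := mkcontfun (@contfun_oppP f).
Definition contfun_mul f g := mkcontfun (@contfun_mulP f g).
Definition contfun_cst c := mkcontfun (@contfun_cstP c).
Definition contfun_scale c f := contfun_mul (contfun_cst c) f.

Fact contfun_addA : associative contfun_add.
Proof. by move=> f g h; apply: contfunP => x; exact: addrA. Qed.
Fact contfun_addC : commutative contfun_add.
Proof. by move=> f g; apply: contfunP => x; exact: addrC. Qed.
Fact contfun_add0 : left_id (contfun_cst 0) contfun_add.
Proof. by move=> f; apply: contfunP => x; exact: add0r. Qed.
Fact contfun_addN : left_inverse (contfun_cst 0) contfun_opp contfun_add.
Proof. by move=> f; apply: contfunP => x; exact: addNr. Qed.

HB.instance Definition _ := GRing.isZmodule.Build (contfun X K)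
  contfun_addA contfun_addC contfun_add0 contfun_addN.

Fact contfun_mulA : associative contfun_mul.
Proof. by move=> f g h; apply: contfunP => x; exact: mulrA. Qed.
Fact contfun_mulC : commutative contfun_mul.
Proof. by move=> f g; apply: contfunP => x; exact: mulrC. Qed.
Fact contfun_mul1 : left_id (contfun_cst 1) contfun_mul.
Proof. by move=> f; apply: contfunP => x; exact: mul1r. Qed.
Fact contfun_mulD : left_distributive contfun_mul contfun_add.
Proof. by move=> f g h; apply: contfunP => x; exact: mulrDl. Qed.

HB.instance Definition _ := GRing.Zmodule_isComPzRing.Build (contfun X K)
  contfun_mulA contfun_mulC contfun_mul1 contfun_mulD.

Fact contfun_scaleA c d f :
  contfun_scale c (contfun_scale d f) = contfun_scale (c * d) f.
Proof. by apply: contfunP => x; exact: mulrA. Qed.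
Fact contfun_scale1 : left_id 1 contfun_scale.
Proof. by move=> f; apply: contfunP => x; exact: mul1r. Qed.
Fact contfun_scaleDr : right_distributive contfun_scale +%R.
Proof. by move=> c f g; apply: contfunP => x; exact: mulrDr. Qed.
Fact contfun_scaleDl f : {morph contfun_scale^~ f : c d / c + d}.
Proof. by move=> c d; apply: contfunP => x; exact: mulrDl. Qed.

HB.instance Definition _ := GRing.Zmodule_isLmodule.Build K (contfun X K)
  contfun_scaleA contfun_scale1 contfun_scaleDr contfun_scaleDl.

Lemma contfunDE f g x : (f + g) x = f x + g x. Proof. by []. Qed.
Lemma contfunNE f x : (- f) x = - f x. Proof. by []. Qed.
Lemma contfunME f g x : (f * g) x = f x * g x. Proof. by []. Qed.
Lemma contfunZE c f x : (c *: f) x = c * f x. Proof. by []. Qed.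
Lemma contfun0E x : (0 : contfun X K) x = 0. Proof. by []. Qed.
Lemma contfun1E x : (1 : contfun X K) x = 1. Proof. by []. Qed.

End ContfunAlgebra.

Section CantorSeminorm.
Variable R : realType.

Definition CC := contfun cantor_space R[i].

HB.instance Definition _ := GRing.ComPzRing.on CC.
HB.instance Definition _ := GRing.Lmodule.on CC.

(* [Normc.normc] is the complex modulus with values in [R]; since
   [cantor_space] is compact, the supremum below is that of a nonempty bounded
   set. *)
Definition supnorm (f : CC) : R :=
  sup [set Normc.normc (f x) | x in [set: cantor_space]].

Lemma eta_continuous (n : nat) :
  continuous ((fun z : cantor_space => ((z n : bool) : nat)%:R) :
              cantor_space -> R[i]^o).
Proof.
move=> z U zU.
have zbool : nbhs (z n : bool) [set z n] by exact: discrete_set1.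
have : nbhs z [set y : cantor_space | y n = z n].
  exact: (@proj_continuous nat (fun=> bool) n z _ zbool).
apply: filterS => y /= zny.
by rewrite /preimage /= zny; exact: nbhs_singleton zU.
Qed.

Definition eta (n : nat) : CC := mkcontfun (@eta_continuous n).

Definition u (n : nat) : CC := 2%:R *: eta n - 1.

Definition uprod (F : {fset nat}) : CC := \prod_(j <- F) u j.

Definition B (n : nat) : set CC :=
  [set uprod F | F in [set F : {fset nat} |
     F != fset0 /\ forall j, j \in F -> (j < n)%N]].

Definition B' (n : nat) : set CC := 1 |` B n.

(* The sums indexed by [B n], [B' n] and their subsets are the library's
   finitely supported sums; these index sets are finite. *)
Definition A (n : nat) : set CC :=
  [set f | exists alpha : CC -> R[i], f = \sum_(a \in B' n) alpha a *: a].

Definition is_state (lam : {scalar CC}) : Prop :=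
  lam 1 = 1 /\
  ereal_sup [set (Normc.normc (lam f))%:E | f in [set f | supnorm f <= 1]]
    = 1%:E.

(* Linearity and boundedness determine [lam] from these values, as the [uprod F]
   together with [1] span a dense subspace of [CC]. *)
Definition is_uniform_state (lam : {scalar CC}) : Prop :=
  is_state lam /\ forall F : {fset nat}, F != fset0 -> lam (uprod F) = 0.

Definition E (lam : {scalar CC}) (n : nat) (f : CC) : CC :=
  \sum_(a \in B' n) lam (f * a) *: a.

Definition Lseminorm (lam : {scalar CC}) (f : CC) : \bar R :=
  ereal_sup (range (fun n : nat =>
    (supnorm (f - E lam n f) / 2%:R ^- n.+1)%:E)).

Definition Cn (n : nat) : set cantor_space :=
  [set x | forall k, (n <= k)%N -> x k = false].

Definition rho (lam : {scalar CC}) (n k : nat) : set CC :=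
  [set a | B n a /\ a - E lam k a != 0].

(* On the complex numbers [Num.sg] is only meaningful at real arguments; it is
   used here for [a] in some [B n], whose values are 1 and -1. *)
Definition pm (a : CC) (x : cantor_space) : R[i] := Num.sg (a x).

End CantorSeminorm.

(* Main.v *)
(* The products [uprod F] are orthonormal for [lam], because
   [uprod F * uprod G = uprod (F symdiff G)]. Hence [E lam k] is the coordinate
   projection that keeps the [F] contained in {0, ..., k-1}, so [f - E lam k f]
   is the part of [f] supported on [rho lam n k]. This function depends on the
   first [n] coordinates only, so its sup norm is attained on [Cn n]; it
   vanishes for [k >= n], which reduces the supremum over [k] to [k < n]. *)
Require Import Defs.
From mathcomp Require Import all_boot all_order all_algebra finmap complex.
From mathcomp Require Import boolp classical_sets functions cardinality fsbigop.
From mathcomp Require Import reals ereal topology normedtype cantor.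
Import Order.TTheory GRing.Theory Num.Theory.
Local Open Scope classical_set_scope.
Local Open Scope card_scope.
Local Open Scope ring_scope.

(** * Finite subsets of {0, ..., n-1} as indices *)

Definition initial_subsets (n : nat) : {fset {fset nat}} :=
  fpowerset [fset i in iota 0 n]%fset.

Lemma initial_subsetsP (n : nat) (F : {fset nat}) :
  reflect (forall j, j \in F -> (j < n)%N) (F \in initial_subsets n).
Proof.
rewrite /initial_subsets fpowersetE; apply: (iffP idP) => [/fsubsetP h j /h|h].
  by rewrite !inE mem_iota add0n.
by apply/fsubsetP => j /h; rewrite !inE mem_iota add0n.
Qed.

Lemma card_initial_subsets (n : nat) : #|` initial_subsets n|%fset = (2 ^ n)%N.
Proof.
rewrite card_fpowerset; congr (2 ^ _)%N.
by rewrite card_fseq undup_id ?iota_uniq // size_iota.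
Qed.

Lemma initial_subsetsS (m n : nat) : (m <= n)%N ->
  (initial_subsets m `<=` initial_subsets n)%fset.
Proof.
move=> mn; apply/fsubsetP => F /initial_subsetsP Fm.
by apply/initial_subsetsP => j /Fm jm; exact: leq_trans mn.
Qed.

(** This and the next lemma move cardinalities and sums to finite sets of indices: [Cn n], [B n],
    [B' n] and [rho lam n k] will all be injective images of sets built from [initial_subsets]. *)
Lemma card_eq_image_fset {T : choiceType} {U : Type} {f : T -> U}
  {X : {fset T}} : injective f -> f @` [set` X] #= `I_#|` X|%fset.
Proof.
move=> fi; apply: card_eq_trans; last first.
  by apply/card_eq_fsetP; reflexivity.
by apply: inj_card_eq => x y _ _; exact: fi.
Qed.

Lemma bigfs_image_fset {V : Type} {idx : V} (op : Monoid.com_law idx)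
  {T U : choiceType} {f : T -> U} {X : {fset T}} {G : U -> V} : injective f ->
  \big[op/idx]_(a \in f @` [set` X]) G a = \big[op/idx]_(x <- X) G (f x).
Proof.
move=> fi; rewrite fsbig_image; last by move=> x y _ _; exact: fi.
by rewrite fsbig_finite // set_fsetK.
Qed.

(** * Points of the Cantor space with finite support *)

Definition indicator_point (F : {fset nat}) : cantor_space := fun k => k \in F.

Lemma indicator_point_inj : injective indicator_point.
Proof.
move=> F G FG; apply/fsetP => k.
exact: (congr1 (fun x : cantor_space => x k) FG).
Qed.

(** A retraction of the Cantor space onto [Cn n]. *)
Definition truncate_point (n : nat) (x : cantor_space) : cantor_space :=
  fun k => if (k < n)%N then x k else false.

Lemma Cn_truncate_point (n : nat) (x : cantor_space) : Cn n (truncate_point n x).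
Proof. by move=> k nk; rewrite /truncate_point ltnNge nk. Qed.

Lemma CnE (n : nat) : Cn n = indicator_point @` [set` initial_subsets n].
Proof.
apply/seteqP; split => x /=.
  move=> xn; exists [fset i in [seq i <- iota 0 n | x i]]%fset.
    by apply/initial_subsetsP => j; rewrite !inE mem_filter mem_iota => /andP[].
  apply: functional_extensionality_dep => k.
  rewrite /indicator_point !inE mem_filter mem_iota add0n.
  by case: leqP => [/xn ->|]; rewrite ?andbT.
move=> [F /initial_subsetsP Fn <-] k nk; apply/negP => /Fn.
by rewrite ltnNge nk.
Qed.

(** * Walsh functions: the products [uprod R F] *)

Section Walsh.
Variable R : realType.

Lemma contfun_sumE (I : Type) (r : seq I) (g : I -> CC R) (x : cantor_space) :
  (\sum_(i <- r) g i) x = \sum_(i <- r) (g i x : R[i]).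
Proof. by elim/big_rec2: _ => // i y1 y2 _ <-. Qed.

Lemma contfun_prodE (I : Type) (r : seq I) (g : I -> CC R) (x : cantor_space) :
  (\prod_(i <- r) g i) x = \prod_(i <- r) (g i x : R[i]).
Proof. by elim/big_rec2: _ => // i y1 y2 _ <-. Qed.

Lemma u_eval (j : nat) (x : cantor_space) :
  u R j x = if x j then 1 else -1.
Proof.
have -> : u R j x = 2%:R * ((x j : bool) : nat)%:R - 1 by [].
by case: (x j); rewrite ?mulr1 ?mulr0 ?sub0r // mulr2n addrK.
Qed.

Lemma uprod_eval (F : {fset nat}) (x : cantor_space) :
  uprod R F x = \prod_(j <- F) (if x j then 1 else -1).
Proof. by rewrite contfun_prodE; apply: eq_bigr => j _; exact: u_eval. Qed.

Lemma uprod_sign (F : {fset nat}) (x : cantor_space) :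
  uprod R F x = 1 \/ uprod R F x = -1.
Proof.
rewrite uprod_eval; elim/big_ind: _ => [|a b|j _]; first by left.
- by move=> [->|->] [->|->]; rewrite ?mulrNN ?mulr1 ?mul1r; auto.
- by case: (x j); auto.
Qed.

(** A number equal to 1 or -1 is its own sign. The signed sums of the theorem are therefore values
    of linear combinations of the [uprod R F]. *)
Lemma pm_uprod (F : {fset nat}) (x : cantor_space) :
  pm (uprod R F) x = uprod R F x.
Proof.
rewrite /pm; case: (uprod_sign F x) => ->; first exact: sgr1.
by apply: ltr0_sg; rewrite oppr_lt0 ltr01.
Qed.

Lemma uprod0 : uprod R fset0 = 1.
Proof. by rewrite /uprod big_seq_fset0. Qed.

(* The point with a single [false] coordinate [k] detects whether [k] is in
   [F]. *)
Lemma uprod_inj : injective (uprod R).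
Proof.
have E (F : {fset nat}) k : uprod R F (fun i => i != k) = (-1) ^+ (k \in F).
  rewrite uprod_eval; case: (boolP (k \in F)) => kF.
    rewrite (big_fsetD1 k) //= eqxx /= expr1 big_seq big1 ?mulr1 // => j.
    by rewrite !inE => /andP[->].
  rewrite big_seq big1 // => j jF.
  by case: eqP => //= jk; move: kF; rewrite -jk jF.
move=> F G FG; apply/fsetP => k; move: (E F k); rewrite FG E.
have /eqP N : (1 : R[i]) != -1 by rewrite -addr_eq0 -mulr2n pnatr_eq0.
by case: (k \in F); case: (k \in G) => //= h; case: N.
Qed.

Lemma uprod_mulss (F : {fset nat}) : uprod R F * uprod R F = 1.
Proof.
apply: contfunP => x; rewrite contfunME contfun1E.
by case: (uprod_sign F x) => ->; rewrite ?mulrNN mulr1.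
Qed.

Lemma uprodU (F G : {fset nat}) : [disjoint F & G]%fset ->
  uprod R (F `|` G)%fset = uprod R F * uprod R G.
Proof.
move=> /fdisjointP FG; rewrite /uprod (big_fsetID _ (mem F)) /=.
congr (_ * _); apply: eq_fbigl => j; rewrite !inE.
  by case: (j \in F); rewrite ?andbF.
by case: (boolP (j \in F)) => [/FG/negbTE ->|_]; rewrite ?andbT ?andbF.
Qed.

Definition fset_symdiff (F G : {fset nat}) : {fset nat} :=
  ((F `\` G) `|` (G `\` F))%fset.

(** Each factor splits along the intersection of [F] and [G]; the common part occurs squared, hence
    contributes 1. *)
Lemma uprodM (F G : {fset nat}) :
  uprod R F * uprod R G = uprod R (fset_symdiff F G).
Proof.
have D (H K : {fset nat}) : uprod R H = uprod R (H `&` K)%fset * uprod R (H `\` K)%fset.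
  rewrite -uprodU ?fsetID //.
  by apply/fdisjointP => j; rewrite !inE => /andP[_ ->].
rewrite (D F G) (D G F) fsetIC mulrACA uprod_mulss mul1r -uprodU //.
by apply/fdisjointP => j; rewrite !inE => /andP[/negbTE -> ->].
Qed.

Lemma B'E (n : nat) : B' n = uprod R @` [set` initial_subsets n].
Proof.
apply/seteqP; split => a /=.
  move=> [->|[F [F0 Fn] <-]]; last by exists F => //; apply/initial_subsetsP.
  by exists fset0; [apply/initial_subsetsP => j; rewrite inE|exact: uprod0].
move=> [F /initial_subsetsP Fn <-]; have [->|F0] := eqVneq F fset0.
  by left; exact: uprod0.
by right; exists F.
Qed.

Lemma BE (n : nat) : B n = uprod R @` [set` (initial_subsets n `\ fset0)%fset].
Proof.
apply/seteqP; split => a /=.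
  move=> [F [F0 Fn] <-]; exists F => //=; rewrite in_fsetD1 F0 /=.
  exact/initial_subsetsP.
move=> [F /=]; rewrite in_fsetD1 => /andP[F0 /initial_subsetsP Fn] <-.
by exists F.
Qed.

(** * The projections [E lam k] and their remainders *)

Section Expectation.
Variable lam : {scalar CC R}.
Hypothesis hlam : is_uniform_state lam.

Lemma lam_uprod (F : {fset nat}) : lam (uprod R F) = (F == fset0)%:R.
Proof.
case: hlam => [[lam1 _] lam0]; case: eqVneq => [->|/lam0 //].
by rewrite uprod0.
Qed.

(** Orthonormality: a symmetric difference is empty only when the two sets agree. *)
Lemma lam_uprodM (F G : {fset nat}) : lam (uprod R F * uprod R G) = (F == G)%:R.
Proof.
by rewrite uprodM lam_uprod /fset_symdiff fsetU_eq0 !fsetD_eq0 -eqEfsubset.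
Qed.

Lemma E_sum (k : nat) (f : CC R) :
  E lam k f = \sum_(F <- initial_subsets k) lam (f * uprod R F) *: uprod R F.
Proof. by rewrite /E B'E (bigfs_image_fset _ uprod_inj). Qed.

Lemma E_uprod (k : nat) (F : {fset nat}) :
  E lam k (uprod R F) = if F \in initial_subsets k then uprod R F else 0.
Proof.
rewrite E_sum; case: ifPn => Fk.
  rewrite (big_fsetD1 F) //= lam_uprodM eqxx scale1r big_seq big1 ?addr0 // => G.
  by rewrite in_fsetD1 lam_uprodM eq_sym => /andP[/negbTE -> _]; rewrite scale0r.
rewrite big_seq big1 // => G Gk.
rewrite lam_uprodM; case: eqP => [FG|_]; last by rewrite scale0r.
by rewrite FG Gk in Fk.
Qed.

Lemma E_linear (k : nat) (c : R[i]) (f g : CC R) :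
  E lam k (c *: f + g) = c *: E lam k f + E lam k g.
Proof.
rewrite !E_sum scaler_sumr -big_split /=; apply: eq_bigr => F _.
have -> : (c *: f + g) * uprod R F = c *: (f * uprod R F) + g * uprod R F.
  by apply: contfunP => x; rewrite !(contfunDE, contfunME, contfunZE) mulrDl mulrA.
by rewrite linearP scalerDl scalerA.
Qed.

Lemma E_lincomb (k : nat) (r : seq {fset nat}) (c : {fset nat} -> R[i]) :
  E lam k (\sum_(F <- r) c F *: uprod R F) =
  \sum_(F <- r) c F *: E lam k (uprod R F).
Proof.
elim: r => [|F r IH]; last by rewrite !big_cons E_linear IH.
rewrite !big_nil E_sum big1 // => F _.
have -> : 0 * uprod R F = 0 by apply: contfunP => x; exact: mul0r.
by rewrite linear0 scale0r.
Qed.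

Lemma rhoE (n k : nat) :
  rho lam n k = uprod R @` [set` (initial_subsets n `\` initial_subsets k)%fset].
Proof.
apply/seteqP; split => a /=.
  rewrite /rho BE => -[[F /=]]; rewrite in_fsetD1 => /andP[F0 Fn] <-.
  rewrite E_uprod => h; exists F => //=; rewrite in_fsetD Fn andbT.
  by apply: contraNN h => ->; rewrite subrr.
move=> [F /=]; rewrite in_fsetD => /andP[Fk Fn] <-; split.
  rewrite BE; exists F => //=; rewrite in_fsetD1 Fn andbT.
  by apply: contraNneq Fk => ->; apply/initial_subsetsP => j; rewrite inE.
(* If [uprod R F] were 0, multiplying it by itself would give 1 = 0, which evaluation at a point
   refutes. *)
rewrite E_uprod (negbTE Fk) subr0; apply/eqP => /(congr1 (fun f => f * uprod R F)).
rewrite uprod_mulss => /(congr1 (fun f : CC R => f (fun=> true))).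
by rewrite contfunME contfun1E contfun0E mul0r => /eqP; rewrite oner_eq0.
Qed.

(** [E lam k] either fixes or annihilates each product, and no product is 0 since its values are 1
    and -1. *)
Lemma rho_E0 (n k : nat) : rho lam n k = [set a | B n a /\ E lam k a = 0].
Proof.
rewrite rhoE BE; apply/seteqP; split => a /=.
  move=> [F /=]; rewrite in_fsetD => /andP[Fk Fn] <-.
  rewrite E_uprod (negbTE Fk); split=> //; exists F => //=.
  rewrite in_fsetD1 Fn andbT.
  by apply: contraNneq Fk => ->; apply/initial_subsetsP => j; rewrite inE.
move=> [[F /=]]; rewrite in_fsetD1 => /andP[F0 Fn] <- h.
exists F => //=; rewrite in_fsetD Fn andbT; apply/negP => Fk.
move: h; rewrite E_uprod Fk => /(congr1 (fun f : CC R => f (fun=> true))).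
rewrite contfun0E => h; case: (uprod_sign F (fun=> true)) => /eqP; rewrite h.
  by rewrite eq_sym oner_eq0.
by rewrite eq_sym oppr_eq0 oner_eq0.
Qed.

Lemma sub_E_lincomb (n k : nat) (c : {fset nat} -> R[i]) :
  let f := \sum_(F <- (initial_subsets n `\ fset0)%fset) c F *: uprod R F in
  f - E lam k f =
  \sum_(F <- (initial_subsets n `\` initial_subsets k)%fset) c F *: uprod R F.
Proof.
move=> f; rewrite {}/f E_lincomb -sumrB; apply/esym.
transitivity (\sum_(F <- (initial_subsets n `\` initial_subsets k)%fset)
    (c F *: uprod R F - c F *: E lam k (uprod R F))).
  rewrite big_seq [RHS]big_seq; apply: eq_bigr => F.
  by rewrite in_fsetD E_uprod => /andP[/negbTE -> _]; rewrite scaler0 subr0.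
(* The larger index set adds only members of [initial_subsets k], whose terms cancel because
   [E lam k] fixes them. The inclusion holds because [fset0] lies in every [initial_subsets k]. *)
apply: big_fset_incl => [|F].
  apply/fsubsetP => F; rewrite in_fsetD in_fsetD1 => /andP[Fk ->]; rewrite andbT.
  by apply: contraNneq Fk => ->; apply/initial_subsetsP => j; rewrite inE.
rewrite in_fsetD1 in_fsetD E_uprod => /andP[_ ->]; rewrite andbT negbK => ->.
by rewrite subrr.
Qed.

(** The bridge between the two sides of the formula: the inner signed sum is the value of the
    remainder, at every point and not only on [Cn n]. *)
Lemma sub_E_eval (n k : nat) (alpha : CC R -> R[i]) (x : cantor_space) :
  let f := \sum_(a \in B n) alpha a *: a in
  (f - E lam k f) x = \sum_(a \in rho lam n k) pm a x * alpha a.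
Proof.
move=> f; rewrite {}/f BE (bigfs_image_fset _ uprod_inj) rhoE.
rewrite (bigfs_image_fset _ uprod_inj) (sub_E_lincomb _ _ (alpha \o uprod R)).
rewrite contfun_sumE; apply: eq_bigr => F _.
by rewrite pm_uprod mulrC.
Qed.

End Expectation.

(** * Reduction of the sup norm to [Cn n] *)

Lemma sum_rho_truncate_point (lam : {scalar CC R}) (n k : nat)
    (alpha : CC R -> R[i]) (x : cantor_space) :
  \sum_(a \in rho lam n k) pm a (truncate_point n x) * alpha a =
  \sum_(a \in rho lam n k) pm a x * alpha a.
Proof.
apply: eq_fsbigr => a; rewrite inE => -[[F [_ Fn] <-] _].
rewrite /pm !uprod_eval; congr (Num.sg _ * _).
rewrite big_seq [RHS]big_seq; apply: eq_bigr => j /Fn jn.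
by rewrite /truncate_point jn.
Qed.

(* A function of the first [n] coordinates takes finitely many values, all of
   them on [Cn n]. *)
Lemma supnorm_attained (n : nat) (g : CC R) :
  (forall x, g (truncate_point n x) = g x) ->
  (forall x, Normc.normc (g x) <= supnorm g) /\
  exists2 x, Cn n x & supnorm g = Normc.normc (g x).
Proof.
move=> gn.
(* The arg max needs an initial element; [fset0] provides one for every [n]. *)
have F0 : fset0 \in initial_subsets n by apply/initial_subsetsP => j; rewrite inE.
pose F := [arg max_(F > FSetSub F0)
             Normc.normc (g (indicator_point (\val F)))]%O.
have Cn_F : Cn n (indicator_point (\val F)).
  by rewrite CnE; exists (\val F) => //=; exact: valP.
have Fmax x : Normc.normc (g x) <= Normc.normc (g (indicator_point (\val F))).
  rewrite /F; case: Order.TotalTheory.arg_maxP => // G _ Gmax.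
  rewrite -gn; have := Cn_truncate_point n x; rewrite CnE => -[H /= Hn <-].
  exact: (Gmax (FSetSub Hn)).
(* The real supremum requires a nonempty, bounded set: [point] gives an element, and the maximum
   over [Cn n] is itself an upper bound. *)
have supE : supnorm g = Normc.normc (g (indicator_point (\val F))).
  apply/le_anti/andP; split.
    by apply: ge_sup => [|_ [x _ <-]]; [exists (Normc.normc (g point)), point|].
  apply: ub_le_sup; last by exists (indicator_point (\val F)).
  by exists (Normc.normc (g (indicator_point (\val F)))) => _ [x _ <-].
by split=> [x|]; [rewrite supE|exists (indicator_point (\val F))].
Qed.

End Walsh.

Theorem theorem2p7 (R : realType) (lam : {scalar CC R})
  (hlam : is_uniform_state lam) (n : nat) (hn : (2 <= n)%N)
  (f : CC R) (hf : A n f) (alpha : CC R -> R[i])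
  (hfalpha : f = \sum_(a \in B n) alpha a *: a) :
  [/\ Cn n #= `I_(2 ^ n),
      forall k : nat, (k < n)%N ->
        rho lam n k = [set a | B n a /\ E lam k a = 0],
      forall (a : CC R) (x : cantor_space), B n a -> Cn n x ->
        pm a x = 1 \/ pm a x = -1,
      Lseminorm lam f =
        \big[maxe/-oo%E]_(k < n) \big[maxe/-oo%E]_(x \in Cn n)
          (2%:R ^+ k.+1 *
             Normc.normc (\sum_(a \in rho lam n k) pm a x * alpha a))%:E
    & forall k : nat, (k < n)%N -> rho lam n k #= `I_(2 ^ n - 2 ^ k)].
Proof.
split.
- rewrite CnE -card_initial_subsets; exact: card_eq_image_fset indicator_point_inj.
- by move=> k _; exact: rho_E0.
- by move=> _ x [F _ <-] _; rewrite pm_uprod; exact: uprod_sign.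
- pose h k x := \sum_(a \in rho lam n k) pm a x * alpha a.
  have fE k x : (f - E lam k f) x = h k x by rewrite hfalpha sub_E_eval.
  have sup_h k : (forall x, Normc.normc (h k x) <= supnorm (f - E lam k f)) /\
      exists2 x, Cn n x & supnorm (f - E lam k f) = Normc.normc (h k x).
    have [|ub [y yn yE]] := @supnorm_attained R n (f - E lam k f).
      by move=> x; rewrite !fE; exact: sum_rho_truncate_point.
    by split=> [x|]; [rewrite -fE|exists y; rewrite // -fE].
  have finCn : finite_set (Cn n) by rewrite CnE; exact/finite_image/finite_fset.
  have le_rhs k x : (k < n)%N -> Cn n x ->
      ((2%:R ^+ k.+1 * Normc.normc (h k x))%:E <=
        \big[maxe/-oo]_(k < n) \big[maxe/-oo]_(x \in Cn n)
          (2%:R ^+ k.+1 * Normc.normc (h k x))%:E)%E.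
    move=> kn xn; apply: le_trans (le_bigmax _ _ (Ordinal kn)) => /=.
    rewrite fsbig_finite //; apply: le_bigmax_seq => //.
    by rewrite in_fset_set // inE.
  apply/le_anti/andP; split.
    apply: ge_ereal_sup => _ [k _ <-]; rewrite invrK mulrC.
    have [_ [x xn ->]] := sup_h k; have [kn|nk] := ltnP k n; first exact: le_rhs.
    (* For [k >= n], every subset of {0, ..., n-1} lies in [initial_subsets k], so [rho lam n k] is
       empty. *)
    have -> : h k x = 0.
      have /eqP D0 : (initial_subsets n `\` initial_subsets k == fset0)%fset.
        by rewrite fsetD_eq0 initial_subsetsS.
      by rewrite /h rhoE // (bigfs_image_fset _ (@uprod_inj R)) D0 big_seq_fset0.
    (* The right-hand side is at least its term for [k = 0] at the same [x], which is nonnegative;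
       this index is available since [0 < n]. *)
    rewrite Normc.normc0 mulr0; apply: le_trans (le_rhs 0%N x _ xn); last exact: ltnW.
    rewrite lee_fin mulr_ge0 ?exprn_ge0 //.
    by case: (h 0%N x) => a b; exact: sqrtr_ge0.
  (* Conversely, each term on the right is at most the scaled sup norm of the remainder for the same
     [k]; the default [-oo] of the maxima is below everything. *)
  apply: bigmax_le => [|k _]; first exact: leNye.
  rewrite fsbig_finite // big_seq; apply: bigmax_le => [|x _]; first exact: leNye.
  apply: ereal_sup_ge; exists (supnorm (f - E lam k f) / 2%:R ^- k.+1)%:E; first by exists k.
  rewrite invrK mulrC lee_fin ler_wpM2r ?exprn_ge0 //; exact: (sup_h k).1.
(* Both powers of 2 are read as cardinalities of nested sets, so their truncated difference counts
   the set difference that indexes [rho lam n k]. *)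
- move=> k /ltnW kn; rewrite rhoE // -!card_initial_subsets.
  rewrite -cardfsDS ?initial_subsetsS //; exact: card_eq_image_fset (@uprod_inj R).
Qed.
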